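(* Algorithm 1 (described in the context) finishes in a finite number of iterations with an optimal solution of the bilevel problem (ILBFP0). (When it stops at iteration $\tau$, the solution it returns is $(\chi^{\tau-1},p^\tau)$, with optimal value $CVaR^\tau$.)
   Context: Data. $N=\{1,\dots,n\}$ is a set of securities, $B\subseteq N$. For $j\in B$, $\{c_{j1},\dots,c_{js_j}\}$ is a finite set of admissible (nonnegative) unit transaction costs, and $\mathbb{P}\subseteq\mathbb{R}_+^{|B|}$ is a polyhedron. There are $T$ scenarios with probabilities $\pi_t\ge 0$, $\sum_t\pi_t=1$; $r_{jt}\in\mathbb{R}$ is the return of security $j$ in scenario $t$; $\alpha\in(0,1]$ and $\mu_0\in\mathbb{R}$ are given. Broker-dealer constraints on $(p,a)$: $p_j=\sum_{k=1}^{s_j}c_{jk}a_{jk}$, $\sum_{k=1}^{s_j}a_{jk}=1$, $a_{jk}\in\{0,1\}$ for $j\in B$, $k=1,\dots,s_j$; and $p\in\mathbb{P}$. The broker-dealer (follower) problem for a given portfolio $x$ is: maximize $\sum_{j\in B}p_jx_j$ subject to the broker-dealer constraints. Investor constraints on $(x,y,\eta,d)$ given $p$: $y_t=\sum_{j=1}^n r_{jt}x_j-\sum_{i\in B}p_ix_i$ for all $t$; $\sum_{t}\pi_ty_t\ge\mu_0$; $d_t\ge\eta-y_t$ and $d_t\ge0$ for all $t$; $\sum_{j=1}^nx_j\le1$; $x_j\ge0$ for all $j$. (ILBFP0): maximize $\eta-\frac1\alpha\sum_{t=1}^T\pi_td_t$ over $(x,y,\eta,d,p)$ subject to the investor constraints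 and to $p$ being an optimal solution of the broker-dealer problem for $x$. The problem (ILBFP0) is assumed to be feasible. For cost vectors $p^1,\dots,p^\tau$, the problem (ILBFP-Incomplete$^\tau$) in the variables $(x,y,\eta,d,\lambda)$ is: maximize $\eta-\frac1\alpha\sum_{t=1}^T\pi_td_t$ subject to $y_t=\sum_{j=1}^nr_{jt}x_j-\lambda$ for all $t$; $\sum_t\pi_ty_t\ge\mu_0$; $d_t\ge\eta-y_t$, $d_t\ge0$ for all $t$; $\sum_{j=1}^nx_j\le1$; $x_j\ge0$ for all $j$; $\lambda\ge\sum_{j\in B}p_j^\nu x_j$ for $\nu=1,\dots,\tau$. Algorithm 1. Initialization: choose a feasible portfolio $x^0$ and set $CVaR^0=+\infty$. Iteration $\tau=1,2,\dots$: 1. Solve the broker-dealer problem for $x^{\tau-1}$; let $p^\tau$ be an optimal solution. 2. Solve (ILBFP-Incomplete$^\tau$); let $(\chi^\tau,\lambda^\tau)$, with $\chi^\tau=(x^\tau,y^\tau,\eta^\tau,d^\tau)$, be an optimal solution and $CVaR^\tau$ the optimal value. 3. If $\tau\ge2$ and $(\chi^{\tau-1},\lambda^{\tau-1})$ is feasible in (ILBFP-Incomplete$^\tau$), stop and return $(\chi^{\tau-1},p^\tau)$ with value $CVaR^\tau$. Otherwise go to iteration $\tau+1$. *)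

(* Defs.v *)
From HB Require Import structures.
From mathcomp Require Import all_boot all_order all_algebra.
From mathcomp Require Import classical_sets reals.

Set Implicit Arguments.
Unset Strict Implicit.
Unset Printing Implicit Defensive.

Import Order.TTheory GRing.Theory Num.Theory.
Local Open Scope ring_scope.

Definition is_polyhedron (R : realType) (J : finType)
    (P : set {ffun J -> R}) : Prop :=
  exists (m : nat) (A : 'I_m -> {ffun J -> R}) (b : 'I_m -> R),
    forall p, P p <-> forall i, \sum_j A i j * p j <= b i.

(* Vectors of R^|B| are indexed by the subtype of B, so that nothing is
   attached to the securities outside B. *)
Record instance (R : realType) := Instance {
  securities : nat;
  brokered : {set 'I_securities};
  ncosts : {j | j \in brokered} -> nat;
  unit_cost : forall j, 'I_(ncosts j) -> R;
  cost_region : set {ffun {j | j \in brokered} -> R};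
  scenarios : nat;
  prob : 'I_scenarios -> R;
  ret : 'I_securities -> 'I_scenarios -> R;
  risk_level : R;
  target : R
}.

Section Problem.
Variables (R : realType) (D : instance R).

Definition portfolio := {ffun 'I_(securities D) -> R}.
Definition cost_vector := {ffun {j | j \in brokered D} -> R}.

Definition broker_revenue (x : portfolio) (p : cost_vector) : R :=
  \sum_(j : {j | j \in brokered D}) p j * x (val j).

Definition broker_feasible (p : cost_vector)
    (a : forall j, 'I_(ncosts (i := D) j) -> R) : Prop :=
  [/\ forall j, p j = \sum_k unit_cost k * a j k,
      forall j, \sum_k a j k = 1,
      forall j k, a j k = 0 \/ a j k = 1
    & cost_region p].

Definition broker_optimal (x : portfolio) (p : cost_vector) : Prop :=
  (exists a, broker_feasible p a) /\
  (forall p' a', broker_feasible p' a' ->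
     broker_revenue x p' <= broker_revenue x p).

(* The tuple chi = (x, y, eta, d). *)
Record investor_vars := InvestorVars {
  holdings : portfolio;
  outcome : {ffun 'I_(scenarios D) -> R};
  quantile : R;
  shortfall : {ffun 'I_(scenarios D) -> R}
}.

Definition cvar_objective (chi : investor_vars) : R :=
  quantile chi
  - (risk_level D)^-1 * \sum_t prob t * shortfall chi t.

Definition feasible_portfolio (x : portfolio) : Prop :=
  \sum_j x j <= 1 /\ forall j, 0 <= x j.

(* The constraints on chi when the total transaction cost is [cost]. *)
Definition investor_constraints (cost : R) (chi : investor_vars) : Prop :=
  [/\ forall t, outcome chi t = \sum_j ret j t * holdings chi j - cost,
      target D <= \sum_t prob t * outcome chi t,
      forall t, quantile chi - outcome chi t <= shortfall chi t,
      forall t, 0 <= shortfall chi t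
    & feasible_portfolio (holdings chi)].

(* Optimistic bilevel problem: p is a decision variable of the leader. *)
Definition bilevel_feasible (chi : investor_vars) (p : cost_vector) : Prop :=
  investor_constraints (broker_revenue (holdings chi) p) chi /\
  broker_optimal (holdings chi) p.

Definition bilevel_optimal (chi : investor_vars) (p : cost_vector) : Prop :=
  bilevel_feasible chi p /\
  (forall chi' p', bilevel_feasible chi' p' ->
     cvar_objective chi' <= cvar_objective chi).

Definition incomplete_feasible (ps : seq cost_vector)
    (chi : investor_vars) (lambda : R) : Prop :=
  investor_constraints lambda chi /\
  (forall p, p \in ps -> broker_revenue (holdings chi) p <= lambda).

Definition incomplete_optimal (ps : seq cost_vector)
    (chi : investor_vars) (lambda : R) : Prop :=
  incomplete_feasible ps chi lambda /\
  (forall chi' lambda', incomplete_feasible ps chi' lambda' ->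
     cvar_objective chi' <= cvar_objective chi).

(* What iteration tau computes: p^tau, chi^tau and lambda^tau. *)
Record iterate := Iterate {
  it_cost : cost_vector;
  it_vars : investor_vars;
  it_lambda : R
}.

Definition it_cvar (it : iterate) : R := cvar_objective (it_vars it).

(* A history lists the iterations performed so far, the latest one first:
   after iteration tau it is [:: it_tau; ...; it_1]. *)
Definition history := seq iterate.

Definition last_portfolio (x0 : portfolio) (h : history) : portfolio :=
  if h is it :: _ then holdings (it_vars it) else x0.

(* Steps 1 and 2 of the iteration that follows h; any optimal solution of the
   two subproblems may be selected. *)
Definition iteration (x0 : portfolio) (h : history) (it : iterate) : Prop :=
  broker_optimal (last_portfolio x0 h) (it_cost it) /\
  incomplete_optimal (map it_cost (it :: h)) (it_vars it) (it_lambda it).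

(* Step 3: the test made at the end of the latest iteration of h. *)
Definition stops (h : history) : Prop :=
  if h is _ :: prev :: _ then
    incomplete_feasible (map it_cost h) (it_vars prev) (it_lambda prev)
  else False.

Inductive execution (x0 : portfolio) : history -> Prop :=
| exec_init : feasible_portfolio x0 -> execution x0 [::]
| exec_iter h it : execution x0 h -> ~ stops h -> iteration x0 h it ->
    execution x0 (it :: h).

Definition infinite_execution (x0 : portfolio) (it : nat -> iterate) : Prop :=
  forall tau, execution x0 (rev (mkseq it tau)).

End Problem.

(* Main.v *)
Require Import Defs.
From HB Require Import structures.
From mathcomp Require Import all_boot all_order all_algebra.
From mathcomp Require Import mathcomp_extra boolp classical_sets reals.
From mathcomp Require Import topology normedtype derive.
From mathcomp Require Import ring lra.

(* Lowering lambda by s while raising the outcomes and the quantile by s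
   increases the objective by s, so at an optimum of the incomplete problem
   lambda is the largest revenue among the known cost vectors.  When the test of
   step 3 succeeds, lambda^(tau-1) also dominates the revenue of p^tau, hence
   equals it; thus (chi^(tau-1), p^tau) is bilevel feasible, and it is optimal
   because every incomplete problem relaxes the bilevel one.  A repeated cost
   vector triggers the test, and there are only finitely many of them.  The
   incomplete problem is solvable although its feasible set is unbounded: once
   lambda and d take their best values it amounts to maximizing a continuous
   function of (x, eta), where x ranges over a compact set and eta may be clamped
   to a segment because 1/alpha >= 1. *)

Set Implicit Arguments.
Unset Strict Implicit.
Unset Printing Implicit Defensive.

Import Order.TTheory GRing.Theory Num.Theory.
Import numFieldNormedType.Exports.
Local Open Scope ring_scope.

(** * Continuity of finite sums and maxima *)

Lemma continuous_sum (R : realType) (T : topologicalType) (I : finType)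
    (f : I -> T -> R) :
  (forall i, continuous (f i)) -> continuous (fun x => \sum_i f i x).
Proof.
move=> cf x; apply: cvg_big => [|i _]; first exact: add_continuous.
exact: cf.
Qed.

Lemma continuous_wsum (R : realType) (T : topologicalType) (I : finType)
    (c : I -> R) (f : I -> T -> R) :
  (forall i, continuous (f i)) -> continuous (fun x => \sum_i c i * f i x).
Proof.
by move=> cf; apply: continuous_sum => i x; apply: cvgMl_tmp; exact: cf.
Qed.

Lemma continuous_bigmax (R : realType) (T : topologicalType) (I : Type)
    (s : seq I) (f0 : T -> R) (f : I -> T -> R) :
  continuous f0 -> (forall i, continuous (f i)) ->
  continuous (fun x => \big[Num.max/f0 x]_(i <- s) f i x).
Proof.
move=> cf0 cf; elim: s => [|i s IH]; first by under eq_fun do rewrite big_nil.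
under eq_fun do rewrite big_cons.
by move=> x; apply: continuous_max; [exact: cf|exact: IH].
Qed.

(** * Maximizing the conditional value at risk over a compact set *)

Section Cvar.
Local Open Scope classical_set_scope.
Variables (R : realType) (m : nat) (w : 'I_m -> R) (a : R).
Hypotheses (w_ge0 : forall t, 0 <= w t) (w_sum1 : \sum_t w t = 1).
Hypotheses (a_gt0 : 0 < a) (a_le1 : a <= 1).

(* The objective of the investor once each shortfall takes its best value. *)
Definition tail_mean (y : 'I_m -> R) (q : R) : R :=
  q - a^-1 * \sum_t w t * Num.max (q - y t) 0.

Lemma le_tail_mean_shortfall (y d : 'I_m -> R) (q : R) :
  (forall t, q - y t <= d t) -> (forall t, 0 <= d t) ->
  q - a^-1 * \sum_t w t * d t <= tail_mean y q.
Proof.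
move=> yd d0; rewrite lerD2l lerN2 ler_wpM2l ?invr_ge0 ?(ltW a_gt0)//.
by apply: ler_sum => t _; rewrite ler_wpM2l// ge_max yd d0.
Qed.

(** Past all outcomes the slope in [q] is [1 - a^-1], which is at most 0. *)
Lemma tail_mean_above (y : 'I_m -> R) (b q : R) :
  (forall t, y t <= b) -> b <= q -> tail_mean y q <= tail_mean y b.
Proof.
move=> yb bq.
have shift : \sum_t w t * Num.max (q - y t) 0
    = \sum_t w t * Num.max (b - y t) 0 + (q - b).
  rewrite -[q - b]mul1r -w_sum1 mulr_suml -big_split; apply: eq_bigr => t _ /=.
  have := yb t => ybt; rewrite !max_l ?subr_ge0 ?(le_trans ybt)//; ring.
rewrite /tail_mean shift mulrDr.
have : 1 * (q - b) <= a^-1 * (q - b).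
  by rewrite ler_wpM2r ?subr_ge0 ?invf_ge1.
by rewrite mul1r; lra.
Qed.

(** Below all outcomes every shortfall vanishes and [tail_mean y q] is just [q]. *)
Lemma tail_mean_below (y : 'I_m -> R) (b q : R) :
  (forall t, b <= y t) -> q <= b -> tail_mean y q <= tail_mean y b.
Proof.
move=> yb qb.
have flat r : r <= b -> tail_mean y r = r.
  move=> rb; rewrite /tail_mean big1 ?mulr0 ?subr0// => t _.
  by rewrite max_r ?mulr0// subr_le0 (le_trans rb).
by rewrite !flat.
Qed.

Lemma continuous_tail_mean (T : topologicalType) (y : 'I_m -> T -> R)
    (q : T -> R) :
  (forall t, continuous (y t)) -> continuous q ->
  continuous (fun x => tail_mean (y ^~ x) (q x)).
Proof.
move=> cy cq x; apply: cvgB; first exact: cq.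
apply: cvgMl_tmp.
apply: (@continuous_wsum _ _ _ w (fun t x => Num.max (q x - y t x) 0)) => t {}x.
apply: (@continuous_max _ _ (fun x => q x - y t x) (fun=> 0)); last exact: cvg_cst.
by apply: cvgB; [exact: cq|exact: cy].
Qed.

Lemma tail_mean_max (T : topologicalType) (K : set T) (y : 'I_m -> T -> R) :
  K !=set0 -> compact K -> (forall t, continuous (y t)) ->
  exists x q, K x /\
    forall x' q', K x' -> tail_mean (y ^~ x') q' <= tail_mean (y ^~ x) q.
Proof.
move=> K0 cK cy.
have cn : continuous (fun x => \sum_t `|y t x|).
  by apply: continuous_sum => t x; apply: cvg_norm; exact: cy.
have [z _ zM] := compact_EVT_max K0 cK (continuous_subspaceT cn).
(* The maximum over [K] of the summed absolute outcomes bounds each outcome on [K] from both sides,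
   uniformly. *)
pose b := \sum_t `|y t z|.
have yb x t : K x -> - b <= y t x <= b.
  move=> Kx; rewrite -ler_norml; apply: le_trans (zM x _); last exact/mem_set.
  by rewrite (bigD1 t)//= lerDl sumr_ge0.
have b0 : - b <= b by rewrite ge0_cp// sumr_ge0.
have cKI : compact (K `*` `[- b, b]).
  exact/compact_setX/segment_compact.
have KI0 : ((K `*` `[- b, b]) !=set0).
  by case: K0 => x Kx; exists (x, b); split=> //=; rewrite in_itv/= b0 lexx.
have cF : continuous (fun u : T * R => tail_mean (y ^~ u.1) u.2).
  apply: continuous_tail_mean => [t u|u]; last exact: cvg_snd.
  by apply: continuous_comp; [exact: cvg_fst|exact: cy].
have [[x q] xqK xqM] := compact_EVT_max KI0 cKI (continuous_subspaceT cF).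
exists x, q; split=> [|x' q' Kx']; first by case/set_mem: xqK.
have clamp r : - b <= r <= b -> tail_mean (y ^~ x') r <= tail_mean (y ^~ x) q.
  by move=> rb; apply: (xqM (x', r)); apply/mem_set; split=> //=; rewrite in_itv.
(* A level outside the segment is moved to the nearer endpoint without loss. *)
have [q'b|bq'] := leP q' b; last first.
  apply: le_trans (clamp b _); last by rewrite b0 lexx.
  by apply: tail_mean_above (ltW bq') => t; case/andP: (yb x' t Kx').
have [bq'|q'b'] := leP (- b) q'; first by apply: clamp; rewrite bq'.
apply: le_trans (clamp (- b) _); last by rewrite b0 lexx.
by apply: tail_mean_below (ltW q'b') => t; case/andP: (yb x' t Kx').
Qed.

End Cvar.

(** * Tightness and solvability of the incomplete problem *)

Section Incomplete.
Variables (R : realType) (D : instance R).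
Hypotheses (prob_ge0 : forall t : 'I_(scenarios D), 0 <= prob t)
  (prob_sum1 : \sum_(t < scenarios D) prob t = 1)
  (risk_level_gt0 : 0 < risk_level D) (risk_level_le1 : risk_level D <= 1).

(** [p0] only seeds the maximum; it is taken in [ps] wherever the exact maximum over [ps]
    matters. *)
Definition max_revenue (p0 : cost_vector D) (ps : seq (cost_vector D))
    (x : portfolio D) : R :=
  \big[Num.max/broker_revenue x p0]_(p <- ps) broker_revenue x p.

Lemma le_max_revenue p0 ps x p :
  p \in ps -> broker_revenue x p <= max_revenue p0 ps x.
Proof. by move=> pps; exact: (le_bigmax_seq _ p xpredT). Qed.

Lemma max_revenue_le p0 ps x l :
  p0 \in ps -> (forall p, p \in ps -> broker_revenue x p <= l) ->
  max_revenue p0 ps x <= l.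
Proof.
by move=> p0ps psl; rewrite /max_revenue big_seq bigmax_le// psl.
Qed.

Definition improve (s : R) (chi : investor_vars D) : investor_vars D :=
  InvestorVars (holdings chi) [ffun t => outcome chi t + s]
    (quantile chi + s) (shortfall chi).

Lemma cvar_objective_improve s chi :
  cvar_objective (improve s chi) = cvar_objective chi + s.
Proof. by rewrite /cvar_objective /=; ring. Qed.

Lemma investor_constraints_improve c s chi :
  0 <= s -> investor_constraints c chi ->
  investor_constraints (c - s) (improve s chi).
Proof.
move=> s0 [yE ymu dy d0 xf]; split=> //= [t||t].
- by rewrite ffunE yE; ring.
- apply: le_trans ymu _; apply: ler_sum => t _.
  by rewrite ffunE ler_wpM2l// lerDl.
- by rewrite ffunE opprD addrACA subrr addr0.
Qed.

Lemma incomplete_optimal_tight p0 ps chi l :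
  p0 \in ps -> incomplete_optimal ps chi l ->
  l = max_revenue p0 ps (holdings chi).
Proof.
move=> p0ps [[ic psl] opt].
have ml := max_revenue_le p0ps psl.
apply/eqP; rewrite eq_le ml andbT -subr_le0.
pose s := l - max_revenue p0 ps (holdings chi).
have s0 : 0 <= s by rewrite subr_ge0.
have := opt (improve s chi) (l - s).
rewrite cvar_objective_improve gerDl; apply; split.
  exact: investor_constraints_improve.
by move=> p pps; rewrite opprB addrC subrK le_max_revenue.
Qed.

Local Open Scope classical_set_scope.

Definition net_return p0 ps (t : 'I_(scenarios D)) (x : portfolio D) : R :=
  \sum_j ret j t * x j - max_revenue p0 ps x.

(** Projection of the incomplete feasible set onto the portfolios: the least allowed [lambda] gives
    the largest outcomes. *)
Definition admissible p0 ps (x : portfolio D) : Prop :=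
  feasible_portfolio x /\ target D <= \sum_t prob t * net_return p0 ps t x.

Section Continuity.
Variables (T : topologicalType) (x : T -> portfolio D).
Hypothesis x_continuous : forall j, continuous (fun u => x u j).

Lemma continuous_max_revenue p0 ps :
  continuous (fun u => max_revenue p0 ps (x u)).
Proof.
have crev p : continuous (fun u => broker_revenue (x u) p).
  exact: (@continuous_wsum _ _ _ p (fun j u => x u (val j))).
exact: (@continuous_bigmax _ _ _ ps _ (fun p u => broker_revenue (x u) p)).
Qed.

Lemma continuous_net_return p0 ps t :
  continuous (fun u => net_return p0 ps t (x u)).
Proof.
move=> u; apply: cvgB; last exact: continuous_max_revenue.
exact: (@continuous_wsum _ _ _ (fun j => ret j t) (fun j u => x u j)).
Qed.

Lemma closed_admissible p0 ps : closed [set u | admissible p0 ps (x u)].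
Proof.
have closed_sup (g : T -> R) c : continuous g -> closed [set u | c <= g u].
  move=> cg; apply: (@preimage_closed _ _ g [set r | c <= r]) => [u _|].
    exact: cg.
  exact: closed_ge.
(* The budget constraint is negated so that every constraint is a superlevel set of a continuous
   function. *)
have -> : [set u | admissible p0 ps (x u)] =
    [set u | -1 <= - \sum_j x u j] `&` \bigcap_j [set u | 0 <= x u j] `&`
    [set u | target D <= \sum_t prob t * net_return p0 ps t (x u)].
  apply/seteqP; split=> [u [[xs x0] xt]|u [[/= xs x0] xt]]; split=> //.
    by split=> /=; [rewrite lerN2|move=> j _; exact: x0].
  by split; [rewrite -lerN2|move=> j; exact: x0].
apply: closedI; [apply: closedI|]; (apply: closed_bigI || apply: closed_sup).
- by move=> u; apply: cvgN; exact: continuous_sum.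
- by move=> j _; exact: closed_sup.
- apply: (@continuous_wsum _ _ _ (@prob _ D)
    (fun t u => net_return p0 ps t (x u))).
  by move=> t; exact: continuous_net_return.
Qed.

End Continuity.

Lemma incomplete_optimal_exists p0 ps chi l :
  p0 \in ps -> incomplete_feasible ps chi l ->
  exists (chi' : investor_vars D) (l' : R),
    incomplete_optimal ps chi' l'.
Proof.
move=> p0ps chil.
have adm chi' l' : incomplete_feasible ps chi' l' ->
    [/\ admissible p0 ps (holdings chi'),
        max_revenue p0 ps (holdings chi') <= l' &
        forall t, outcome chi' t <= net_return p0 ps t (holdings chi')].
  move=> [[yE ymu _ _ xf] psl].
  have ml := max_revenue_le p0ps psl.
  have yn t : outcome chi' t <= net_return p0 ps t (holdings chi').
    by rewrite yE lerD2l lerN2.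
  split=> //; split=> //; apply: le_trans ymu _.
  by apply: ler_sum => t _; rewrite ler_wpM2l.
(* Portfolios are parametrized by plain functions with the product topology, so that Tychonoff makes
   the unit cube compact. *)
pose T := prod_topology (fun _ : 'I_(securities D) => R).
pose x (f : T) : portfolio D := [ffun j => f j].
have cx j : continuous (fun f : T => x f j).
  rewrite (_ : (fun f => _) = proj j); first exact: proj_continuous.
  by apply/funext => f; rewrite ffunE.
pose K := [set f : T | admissible p0 ps (x f)].
have xK z : admissible p0 ps z -> exists2 f, K f & x f = z.
  have xz : x z = z by apply/ffunP => j; rewrite ffunE.
  by move=> za; exists z; rewrite /K/= ?xz.
have cK : compact K.
  pose cube := [set f : T | forall j, `[0, 1]%classic (f j)].
  have ccube : compact cube.
    apply: (@tychonoff _ (fun=> R) (fun=> `[0, 1]%classic)) => j.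
    exact: segment_compact.
  apply: (@subclosed_compact _ K cube) => //; first exact: closed_admissible.
  move=> f [[xs x0] _] j /=; have := x0 j; rewrite ffunE in_itv/= => -> /=.
  by apply: le_trans xs; rewrite (bigD1 j)//= ffunE lerDl sumr_ge0.
have K0 : K !=set0.
  by have [/xK[f Kf _] _ _] := adm _ _ chil; exists f.
have cy t : continuous (fun f : T => net_return p0 ps t (x f)).
  exact: continuous_net_return.
have [f [q [Kf fq]]] :=
  tail_mean_max prob_sum1 risk_level_gt0 risk_level_le1 K0 cK cy.
pose y t := net_return p0 ps t (x f).
exists (InvestorVars (x f) [ffun t => y t] q [ffun t => Num.max (q - y t) 0]).
exists (max_revenue p0 ps (x f)); split.
  split=> [|p pps]; last exact: le_max_revenue.
  case: Kf => xf xt; split=> //= [t||t|t].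
  - by rewrite ffunE.
  - by apply: le_trans xt _; apply: ler_sum => t _; rewrite ffunE.
  - by rewrite !ffunE le_max lexx.
  - by rewrite ffunE le_max lexx orbT.
(* The competitor's outcomes are at most its net returns, so its shortfalls also satisfy the bounds
   for those returns. *)
move=> chi' l' chil'; have [/xK[f' Kf' xf'] _ yn] := adm _ _ chil'.
case: chil' => -[_ _ yd d0 _] _.
rewrite /cvar_objective /=; under [in leRHS]eq_bigr do rewrite ffunE.
apply: le_trans (fq f' (quantile chi') Kf').
apply: le_tail_mean_shortfall => // t; apply: le_trans (yd t).
by rewrite xf' lerD2l lerN2.
Qed.

End Incomplete.

(** * Finiteness of the broker's choices and of the running executions *)

Section Broker.
Variables (R : realType) (D : instance R).

Definition broker_choice :=
  {dffun forall j : {j | j \in brokered D}, 'I_(ncosts j)}.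

Definition choice_cost (k : broker_choice) : cost_vector D :=
  [ffun j => unit_cost (k j)].

(** A 0/1 row summing to 1 has an entry 1, and the other entries, nonnegative of sum 0, all
    vanish. *)
Lemma broker_feasible_choice p a :
  broker_feasible (D := D) p a -> exists k, p = choice_cost k.
Proof.
move=> [pE a1 a01 _].
have kex j : exists k : 'I_(ncosts j), p j = unit_cost k.
  have [k ak] : exists k, a j k = 1.
    apply: contrapT => /forallNP ak; have := a1 j; rewrite big1.
      by move/eqP; rewrite eq_sym oner_eq0.
    by move=> k _; have [//|/ak] := a01 j k.
  exists k; rewrite pE (bigD1 k)//= ak mulr1 big1 ?addr0// => i ik.
  have a0 l : l != k -> 0 <= a j l by case: (a01 j l) => ->.
  have /(psumr_eq0P a0)-> : \sum_(l | l != k) a j l = 0; rewrite ?mulr0//.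
  by have := a1 j; rewrite (bigD1 k)//= ak -[RHS]addr0 => /addrI.
have [k kP] := fin_all_exists kex.
exists [ffun j => k j].
by apply/ffunP => j; rewrite !ffunE kP.
Qed.

Lemma broker_optimal_exists x p a :
  broker_feasible (D := D) p a -> exists p' : cost_vector D, broker_optimal x p'.
Proof.
move=> pa; have [k0 k0E] := broker_feasible_choice pa.
pose P (k : broker_choice) := `[< exists b, broker_feasible (choice_cost k) b >].
have Pk0 : P k0 by apply/asboolP; exists a; rewrite -k0E.
have [k /asboolP kP kmax] :=
  arg_maxP (fun k => broker_revenue x (choice_cost k)) Pk0.
exists (choice_cost k); split=> // p' a' pa'.
have [k' k'E] := broker_feasible_choice pa'.
by rewrite k'E; apply: kmax; apply/asboolP; exists a'; rewrite -k'E.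
Qed.

(** The relaxation: the broker's optimal revenue dominates that of every known feasible cost vector,
    so each cut holds. *)
Lemma bilevel_incomplete_feasible ps chi p :
  (forall q, q \in ps -> exists b, broker_feasible q b) ->
  bilevel_feasible chi p ->
  incomplete_feasible (D := D) ps chi (broker_revenue (holdings chi) p).
Proof.
move=> psf [ic [_ popt]]; split=> // q qps.
by have [b] := psf q qps; exact: popt.
Qed.

(** A repeated cost vector adds a cut that the previous solution already satisfies. *)
Lemma stops_repeat x0 it prev h :
  iteration (D := D) x0 h prev -> it_cost it \in map (@it_cost R D) (prev :: h) ->
  stops [:: it, prev & h].
Proof.
move=> [_ [[ic pl] _]] rep; split=> // p.
by rewrite inE => /predU1P[->|]; exact: pl.
Qed.

Lemma execution_cons x0 it h :
  execution (D := D) x0 (it :: h) ->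
  [/\ execution x0 h, ~ stops h & iteration x0 h it].
Proof. by move=> exh; inversion exh. Qed.

Lemma execution_cost_feasible x0 h :
  execution (D := D) x0 h ->
  forall p, p \in map (@it_cost R D) h -> exists b, broker_feasible p b.
Proof.
elim=> [//|{}h it _ IH _ [[pf _] _] p].
by rewrite inE => /predU1P[->|]; [exact: pf|exact: IH].
Qed.

Lemma execution_cost_uniq x0 h :
  execution (D := D) x0 h -> ~ stops h -> uniq (map (@it_cost R D) h).
Proof.
elim=> [//|{}h it exh IH nst itP nst'] /=; rewrite IH// andbT.
case: exh nst' {IH nst itP} => [//|h' prev _ _ itP nst'].
by apply/negP => /(stops_repeat itP).
Qed.

Lemma size_running_execution x0 h :
  execution (D := D) x0 h -> ~ stops h -> (size h <= #|{: broker_choice}|)%N.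
Proof.
move=> exh nst; rewrite -(size_map (@it_cost R D)) cardE -(size_map choice_cost).
apply: uniq_leq_size (execution_cost_uniq exh nst) _ => p ph.
have [b pb] := execution_cost_feasible exh ph.
by have [k ->] := broker_feasible_choice pb; rewrite map_f ?mem_enum.
Qed.

End Broker.

(** * Progress, termination and correctness of the algorithm *)

Section Algorithm.
Variables (R : realType) (D : instance R).
Hypotheses (prob_ge0 : forall t : 'I_(scenarios D), 0 <= prob t)
  (prob_sum1 : \sum_(t < scenarios D) prob t = 1)
  (risk_level_gt0 : 0 < risk_level D) (risk_level_le1 : risk_level D <= 1).

Lemma iteration_exists x0 h chi p :
  bilevel_feasible (D := D) chi p -> execution x0 h ->
  exists it : iterate D, iteration x0 h it.
Proof.
move=> chip exh; have [_ [[a pa] _]] := chip.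
have [q qopt] := broker_optimal_exists (last_portfolio x0 h) pa.
pose ps := q :: map (@it_cost R D) h.
have psf r : r \in ps -> exists b, broker_feasible r b.
  rewrite inE => /predU1P[->|]; first by case: qopt.
  exact: (execution_cost_feasible exh).
have [chi' [l' opt']] := incomplete_optimal_exists prob_ge0 prob_sum1
  risk_level_gt0 risk_level_le1 (mem_head q _)
  (bilevel_incomplete_feasible psf chip).
by exists (Iterate q chi' l').
Qed.

Lemma not_infinite_execution x0 it : ~ infinite_execution (D := D) x0 it.
Proof.
(* Dropping the latest iteration leaves a history that has not stopped, still one longer than the
   bound allows. *)
move=> inf; have := inf #|{: broker_choice D}|.+2.
rewrite mkseqS rev_rcons.
move=> /execution_cons[exh nst _].
by have := size_running_execution exh nst; rewrite size_rev size_mkseq ltnn.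
Qed.

Lemma stop_optimal x0 last prev h :
  execution (D := D) x0 [:: last, prev & h] -> stops [:: last, prev & h] ->
  bilevel_optimal (it_vars prev) (it_cost last) /\
  cvar_objective (it_vars prev) = it_cvar last.
Proof.
move=> exh st.
have [exh1 _ [lastopt [[lastic lastps] lastmax]]] := execution_cons exh.
have [_ _ [_ prevopt]] := execution_cons exh1.
have lE := incomplete_optimal_tight prob_ge0 (mem_head _ _) prevopt.
case: (prevopt) => -[previc prevps] prevmax.
have costf := execution_cost_feasible exh.
(* The stopping test gives one inequality; the other holds because the last cost vector is the
   broker's best reply to the previous portfolio. *)
have tight : it_lambda prev =
    broker_revenue (holdings (it_vars prev)) (it_cost last).
  apply/eqP; rewrite eq_le (st.2 _ (mem_head _ _)) andbT lE.
  apply: max_revenue_le (mem_head _ _) _ => q qh.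
  have [|b qb] := costf q; first by rewrite inE qh orbT.
  exact: lastopt.2 qb.
split.
  split; first by split; rewrite -?tight.
  move=> chi p chip; apply: (prevmax _ (broker_revenue (holdings chi) p)).
  by apply: bilevel_incomplete_feasible chip; exact: execution_cost_feasible exh1.
(* Conversely, the last solution is feasible in the previous problem, which has one cut fewer. *)
apply/le_anti/andP; split; first exact: lastmax st.
apply: (prevmax _ (it_lambda last)); split=> // q qh.
by apply: lastps; rewrite inE qh orbT.
Qed.

End Algorithm.

Theorem theorem2 (R : realType) (D : instance R)
  (cost_ge0 : forall (j : {j | j \in brokered D}) (k : 'I_(ncosts j)),
     0 <= unit_cost k)
  (region_polyhedron : is_polyhedron (cost_region (i := D)))
  (region_ge0 : forall p : cost_vector D, cost_region p -> forall j, 0 <= p j)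
  (prob_ge0 : forall t : 'I_(scenarios D), 0 <= prob t)
  (prob_sum1 : \sum_(t < scenarios D) prob t = 1)
  (risk_level_gt0 : 0 < risk_level D)
  (risk_level_le1 : risk_level D <= 1)
  (bilevel_has_feasible :
     exists (chi : investor_vars D) (p : cost_vector D), bilevel_feasible chi p) :
  (exists x0 : portfolio D, feasible_portfolio x0) /\
  forall x0 : portfolio D, feasible_portfolio x0 ->
  [/\ (* every iteration can be carried out *)
      forall h, execution x0 h -> ~ stops h ->
        exists it, iteration x0 h it,
      (* every execution stops after finitely many iterations *)
      ~ (exists it : nat -> iterate D, infinite_execution x0 it)
    & (* when it stops at iteration tau, (chi^(tau-1), p^tau) is optimal *)
      forall (last prev : iterate D) (h : history D),
        execution x0 [:: last, prev & h] -> stops [:: last, prev & h] ->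
        bilevel_optimal (it_vars prev) (it_cost last) /\
        cvar_objective (it_vars prev) = it_cvar last].
Proof.
have [chi [p chip]] := bilevel_has_feasible.
split; first by have [[_ _ _ _ xf] _] := chip; exists (holdings chi).
move=> x0 _; split=> [h exh _|[it inf]|last prev h].
- exact: iteration_exists chip exh.
- exact: not_infinite_execution inf.
- exact: stop_optimal.
Qed.
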